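(* Let $(M(E,I),S)$ be a state space, with $E$ totally ordered by $<$, and let $F:K_*(S)\to\mathrm{Ab}$ be a functor on the augmented state category. If $M(E,I)$ contains no infinite subset of pairwise independent generators, then for every $n\ge 0$ the group $H_n(K_*(S),F)$ is isomorphic to the $n$-th homology group of the complex $$0\leftarrow\bigoplus_{x\in S_*}F(x)\xleftarrow{d_1}\bigoplus_{(x,a_1)\in Q_1(E,I,S)}F(x)\xleftarrow{d_2}\bigoplus_{(x,a_1,a_2)\in Q_2(E,I,S)}F(x)\leftarrow\cdots\xleftarrow{d_n}\bigoplus_{(x,a_1,\dots,a_n)\in Q_n(E,I,S)}F(x)\leftarrow\cdots$$ with differentials $$d_n(x,a_1,\dots,a_n,f)=\sum_{s=1}^n(-1)^s\Big((x\cdot a_s,a_1,\dots,\widehat{a_s},\dots,a_n,F(x\xrightarrow{a_s}x\cdot a_s)(f))-(x,a_1,\dots,\widehat{a_s},\dots,a_n,f)\Big).$$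
   Context: $\mathrm{Ab}$ is the category of Abelian groups. An independence relation on a set $E$ (possibly infinite) is an irreflexive symmetric relation $I\subseteq E\times E$. The trace monoid $M(E,I)$ is the quotient of the free monoid $E^*$ by the least equivalence relation with $uabv\equiv ubav$ for all $(a,b)\in I$ and $u,v\in E^*$. Generators $a,b\in E$ are independent if $(a,b)\in I$. A state space $(M(E,I),S)$ consists of a trace monoid and a partial right action of it on a set $S$: partial maps $s\mapsto s\cdot w$ on $S$ for $w\in M(E,I)$, with $s\cdot 1=s$ for all $s$, and with $s\cdot(vw)$ defined exactly when $s\cdot v$ and $(s\cdot v)\cdot w$ are defined, in which case $s\cdot(vw)=(s\cdot v)\cdot w$. Put $S_*=S\sqcup\{*\}$ and extend the action to a total right action on $S_*$ by setting $s\cdot w=*$ whenever $s\cdot w$ is undefined, and $*\cdot w=*$. The augmented state category $K_*(S)$ has object set $S_*$; morphisms $s\to s'$ are triples $(s,w,s')$ with $w\in M(E,I)$ and $s\cdot w=s'$, also written $s\xrightarrow{w}s'$; the composite of $s\xrightarrow{v}s'$ followed by $s'\xrightarrow{w}s''$ is $s\xrightarrow{vw}s''$. For a small category $\mathscr{C}$ and a functor $F:\mathscr{C}\to\mathrm{Ab}$, $H_n(\mathscr{C},F)$ is the $n$-th left derived functor of the colimit functor $\varinjlim^{\mathscr{C}}:\mathrm{Ab}^{\mathscr{C}}\to\mathrm{Ab}$ evaluated at $F$. For $n\ge0$, $Q_n(E,I,S)$ is the set of tuples $(x,a_1,\dots,a_n)$ with $x\in S_*$ and $a_1,\dots,a_n\in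 E$ such that $a_i<a_j$ and $(a_i,a_j)\in I$ for all $1\le i<j\le n$; in particular $Q_0(E,I,S)=S_*$. In $\bigoplus_{(x,a_1,\dots,a_n)}F(x)$, the symbol $(x,a_1,\dots,a_n,f)$ denotes the element $f\in F(x)$ placed in the summand indexed by $(x,a_1,\dots,a_n)$. A hat denotes omission of the entry. *)

(* Defs.v *)
From HB Require Import structures.
From mathcomp Require Import all_boot all_order all_algebra.
From mathcomp Require Import all_classical.
From mathcomp Require Import zify ring.

Set Implicit Arguments.
Unset Strict Implicit.
Unset Printing Implicit Defensive.

Import GRing.Theory.
Local Open Scope classical_set_scope.
Local Open Scope quotient_scope.
Local Open Scope ring_scope.

Definition addmap (A B : zmodType) (f : A -> B) (fB : zmod_morphism f) :
    {additive A -> B} :=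
  HB.pack f (GRing.isZmodMorphism.Build A B f fB).

Section DependentProduct.
Variables (I : choiceType) (A : I -> zmodType).

Definition dprod := forall i, A i.
HB.instance Definition _ := Choice.on dprod.

Definition dprod_zero : dprod := fun i => 0.
Definition dprod_opp (f : dprod) : dprod := fun i => - f i.
Definition dprod_add (f g : dprod) : dprod := fun i => f i + g i.

Fact dprod_addA : associative dprod_add.
Proof. by move=> f g h; apply: functional_extensionality_dep => i; exact: addrA. Qed.
Fact dprod_addC : commutative dprod_add.
Proof. by move=> f g; apply: functional_extensionality_dep => i; exact: addrC. Qed.
Fact dprod_add0 : left_id dprod_zero dprod_add.
Proof. by move=> f; apply: functional_extensionality_dep => i; exact: add0r. Qed.
Fact dprod_addN : left_inverse dprod_zero dprod_opp dprod_add.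
Proof. by move=> f; apply: functional_extensionality_dep => i; exact: addNr. Qed.

HB.instance Definition _ :=
  GRing.isZmodule.Build dprod dprod_addA dprod_addC dprod_add0 dprod_addN.

Definition dsupp (f : dprod) : set I := [set i | f i != 0].
Definition fin_supp : pred dprod := fun f => `[< finite_set (dsupp f) >].

Fact fin_supp_zmod_closed : zmod_closed fin_supp.
Proof.
split=> [|f g /asboolP ff /asboolP fg].
  apply/asboolP; suff -> : dsupp 0 = set0 by [].
  by apply/seteqP; split=> i //=; rewrite /dsupp /= => /eqP; apply.
apply/asboolP; apply: (@sub_finite_set _ _ (dsupp f `|` dsupp g)).
  move=> i; rewrite /dsupp /= => fgi.
  have [fi0|fi] := eqVneq (f i) 0; [right|by left].
  apply: contra fgi => /eqP gi0.
  by rewrite /GRing.add /GRing.opp /= /dprod_add /dprod_opp fi0 gi0 subrr.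
by rewrite finite_setU.
Qed.

Definition dsum := {f : dprod | fin_supp f}.
HB.instance Definition _ := SubChoice.on dsum.
HB.instance Definition _ :=
  GRing.SubChoice_isSubZmodule.Build dprod fin_supp dsum fin_supp_zmod_closed.

End DependentProduct.
Arguments fin_supp {I} A.

Section DirectSum.
Variables (I : choiceType) (A : I -> zmodType).
Implicit Types (f g : dsum A).

Lemma dsumP f g : (forall i, val f i = val g i) -> f = g.
Proof. by move=> fg; apply/val_inj/functional_extensionality_dep. Qed.

Lemma dsum_subE f g i : val (f - g) i = val f i - val g i.
Proof. by rewrite raddfB. Qed.

Definition dsum_in_fun i (a : A i) : dprod A := fun j =>
  if i =P j is ReflectT ij then ecast k (A k) ij a else 0.

Lemma dsum_in_fun_id i (a : A i) : dsum_in_fun a i = a.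
Proof. by rewrite /dsum_in_fun; case: eqP => // p; rewrite eq_axiomK. Qed.

Lemma dsum_in_fun_neq i j (a : A i) : i != j -> dsum_in_fun a j = 0.
Proof. by move=> /eqP ij; rewrite /dsum_in_fun; case: eqP. Qed.

Fact dsum_in_fin i (a : A i) : fin_supp A (dsum_in_fun a).
Proof.
apply/asboolP; apply: (@sub_finite_set _ _ [set i]) => // j; rewrite /dsupp /=.
by apply: contraNP => ij; rewrite dsum_in_fun_neq //; apply/eqP=> /esym.
Qed.

Definition dsum_in_raw i (a : A i) : dsum A := 
  exist (fun u => fin_supp A u) _ (dsum_in_fin a).

Fact dsum_in_zmod i : zmod_morphism (@dsum_in_raw i).
Proof.
move=> a b; apply: dsumP => j; rewrite dsum_subE /=.
have [<-|ij] := eqVneq i j; first by rewrite !dsum_in_fun_id.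
by rewrite !dsum_in_fun_neq // subrr.
Qed.

Definition dsum_in i : {additive A i -> dsum A} := addmap (@dsum_in_zmod i).

Section Rec.
Variables (B : zmodType) (g : forall i, {additive A i -> B}).

Definition dsum_rec_fun f : B := \sum_(i \in [set: I]) g i (val f i).

Lemma dsum_rec_funE f (r : seq I) : uniq r -> dsupp (val f) `<=` [set` r] ->
  dsum_rec_fun f = \sum_(i <- r) g i (val f i).
Proof.
move=> ur fr; rewrite /dsum_rec_fun (fsbigE r) //=.
  by apply: eq_bigl => i; rewrite in_setT.
move=> i _; apply: contraNeq => gi; apply: fr; rewrite /dsupp /=.
by apply: contra_neq gi => ->; rewrite raddf0.
Qed.

Lemma dsum_suppP f :
  exists2 r : seq I, uniq r & dsupp (val f) `<=` [set` r].
Proof.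
have /asboolP/finite_seqP[s fs] := valP f.
by exists (undup s); [exact: undup_uniq | move=> i; rewrite fs /= mem_undup].
Qed.

Fact dsum_rec_zmod : zmod_morphism dsum_rec_fun.
Proof.
move=> f h; have [r _ fr] := dsum_suppP f; have [s _ hs] := dsum_suppP h.
have [t _ ft] := dsum_suppP (f - h).
rewrite !(@dsum_rec_funE _ (undup (r ++ s ++ t))) ?undup_uniq //.
- by rewrite -sumrB; apply: eq_bigr => i _; rewrite dsum_subE raddfB.
- by move=> i /hs /=; rewrite mem_undup !mem_cat => ->; rewrite orbT.
- by move=> i /fr /=; rewrite mem_undup !mem_cat => ->.
- by move=> i /ft /=; rewrite mem_undup !mem_cat => ->; rewrite !orbT.
Qed.

Definition dsum_rec : {additive dsum A -> B} := addmap dsum_rec_zmod.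

Lemma dsum_rec_in i (a : A i) : dsum_rec (dsum_in i a) = g i a.
Proof.
rewrite /= (@dsum_rec_funE _ [:: i]) //.
  by rewrite big_seq1 /= dsum_in_fun_id.
move=> j; rewrite /dsupp /= inE; apply: contraNT => ij.
by rewrite dsum_in_fun_neq // eq_sym.
Qed.

End Rec.

Lemma dsum_decomp f (r : seq I) : uniq r -> dsupp (val f) `<=` [set` r] ->
  f = \sum_(i <- r) dsum_in i (val f i).
Proof.
move=> ur fr; apply: dsumP => j.
have -> : val (\sum_(i <- r) dsum_in i (val f i)) j =
          \sum_(i <- r) dsum_in_fun (val f i) j.
  elim: (r) => [|i s IH]; first by rewrite !big_nil.
  by rewrite !big_cons -IH.
have [jr|jr] := boolP (j \in r).
  rewrite (bigD1_seq j) //= dsum_in_fun_id big1 ?addr0 // => i ij.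
  by rewrite dsum_in_fun_neq.
rewrite big_seq big1 => [|i ir]; last first.
  by rewrite dsum_in_fun_neq //; apply: contraNneq jr => <-.
by apply/eqP; apply: contraNT jr => /fr.
Qed.

Lemma dsum_ext (B : zmodType) (g h : {additive dsum A -> B}) :
  (forall i a, g (dsum_in i a) = h (dsum_in i a)) -> g =1 h.
Proof.
move=> gh f; have [r ur fr] := dsum_suppP f.
by rewrite (dsum_decomp ur fr) !raddf_sum; apply: eq_bigr => i _; exact: gh.
Qed.

End DirectSum.
Arguments dsum_in {I A} i.

Section Kernel.
Variables (A B : zmodType) (f : {additive A -> B}).

Definition kerf : pred A := fun a => f a == 0.

Fact kerf_zmod_closed : zmod_closed kerf.
Proof.
split=> [|a b]; rewrite /in_mem /= /kerf; first by rewrite raddf0.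
by move=> /eqP fa /eqP fb; rewrite raddfB fa fb subrr.
Qed.

Definition ker := {a : A | kerf a}.
HB.instance Definition _ := SubChoice.on ker.
HB.instance Definition _ :=
  GRing.SubChoice_isSubZmodule.Build A kerf ker kerf_zmod_closed.

Lemma kerP (a : ker) : f (val a) = 0. Proof. exact/eqP/(valP a). Qed.

Definition ker_val : {additive ker -> A} := val.

Variables (C : zmodType) (g : {additive C -> A}) (fg : forall c, f (g c) = 0).

Definition ker_lift_fun c : ker :=
  exist (fun a => kerf a) (g c) (introT eqP (fg c)).

Fact ker_lift_zmod : zmod_morphism ker_lift_fun.
Proof. by move=> c d; apply: val_inj; rewrite raddfB /= raddfB. Qed.

Definition ker_lift : {additive C -> ker} := addmap ker_lift_zmod.

End Kernel.

Section Cokernel.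
Variables (A B : zmodType) (f : {additive A -> B}).

Definition imf : pred B := fun b => `[< exists a, f a = b >].

Fact imf_zmod_closed : zmod_closed imf.
Proof.
split=> [|_ _ /asboolP[a <-] /asboolP[b <-]]; apply/asboolP.
  by exists 0; rewrite raddf0.
by exists (a - b); rewrite raddfB.
Qed.
Definition im : zmodClosed B :=
  HB.pack imf (GRing.isZmodClosed.Build B imf imf_zmod_closed).

Definition coker : zmodType := Quotient.quot im.

Fact coker_pi_zmod : zmod_morphism (\pi_(Quotient.quot im) : B -> coker).
Proof. exact: raddfB. Qed.

Definition coker_pi : {additive B -> coker} := addmap coker_pi_zmod.

Lemma coker_piP (c : coker) : exists b, coker_pi b = c.
Proof. by exists (repr c); rewrite /= reprK. Qed.

Lemma coker_pi_eq0 b : coker_pi b = 0 <-> exists a, f a = b.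
Proof.
have -> : coker_pi b = 0 <-> is_true (b \in im).
  rewrite -{2}[b]subr0 (Quotient.idealrBE im).
  rewrite -[X in _ = X](raddf0 coker_pi) /=.
  by split=> [->|/eqP].
by split=> [/asboolP|H]; last exact/asboolP.
Qed.

Section Rec.
Variables (C : zmodType) (g : {additive B -> C}) (gf : forall a, g (f a) = 0).

Definition coker_rec_fun (c : coker) : C := g (repr c).

Lemma coker_rec_funE b : coker_rec_fun (coker_pi b) = g b.
Proof.
apply/eqP; rewrite /coker_rec_fun -subr_eq0 -raddfB; apply/eqP.
have /coker_pi_eq0[a <-] : coker_pi (repr (coker_pi b) - b) = 0.
  by rewrite raddfB /= reprK subrr.
exact: gf.
Qed.

Fact coker_rec_zmod : zmod_morphism coker_rec_fun.
Proof.
move=> c d; have [b <-] := coker_piP c; have [b' <-] := coker_piP d.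
by rewrite -raddfB !coker_rec_funE raddfB.
Qed.

Definition coker_rec : {additive coker -> C} := addmap coker_rec_zmod.

Lemma coker_recE b : coker_rec (coker_pi b) = g b.
Proof. exact: coker_rec_funE. Qed.

End Rec.

End Cokernel.

Record chain_complex := ChainComplex {
  cplx :> nat -> zmodType;
  diff : forall n, {additive cplx n.+1 -> cplx n};
  diffK : forall n c, diff n (diff n.+1 c) = 0
}.

(* In degree 0 the complex continues with [0], so homology is a cokernel. *)
Definition homology (C : chain_complex) (n : nat) : zmodType :=
  if n is m.+1 then coker (ker_lift (@diffK C m)) else coker (diff C 0).

Definition zmod_isomorphic (A B : zmodType) : Prop :=
  exists phi : {additive A -> B}, bijective phi.

(* Composition is in diagrammatic order. *)
Record category := Category {
  ob :> choiceType;
  hom : ob -> ob -> choiceType;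
  idm : forall x, hom x x;
  mcomp : forall x y z, hom x y -> hom y z -> hom x z;
  compA : forall x y z t (f : hom x y) (g : hom y z) (h : hom z t),
    mcomp f (mcomp g h) = mcomp (mcomp f g) h;
  comp1m : forall x y (f : hom x y), mcomp (idm x) f = f;
  compm1 : forall x y (f : hom x y), mcomp f (idm y) = f
}.
Arguments hom {c}.
Arguments idm {c}.

Record functor (C : category) := Functor {
  fob :> C -> zmodType;
  fmap : forall x y, hom x y -> {additive fob x -> fob y};
  fmap1 : forall x a, fmap (idm x) a = a;
  fmap_comp : forall x y z (f : hom x y) (g : hom y z) a,
    fmap (mcomp f g) a = fmap g (fmap f a)
}.
Arguments fmap {C} f {x y} : rename.

Record nat_trans (C : category) (F G : functor C) := NatTrans {
  ntr :> forall x, {additive F x -> G x};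
  ntr_nat : forall x y (f : hom x y) a, ntr y (fmap F f a) = fmap G f (ntr x a)
}.

Section Colimit.
Variables (C : category) (F : functor C).

Definition arrow := {x : C & {y : C & hom x y}}.

Definition arrow_rel (u : arrow) : {additive F (tag u) -> dsum F} :=
  (dsum_in (tag (tagged u)) \o fmap F (tagged (tagged u))) \- dsum_in (tag u).

Definition colim_rel : {additive dsum (fun u : arrow => F (tag u)) -> dsum F} :=
  dsum_rec arrow_rel.

Definition colim : zmodType := coker colim_rel.

Definition colim_in x : {additive F x -> colim} :=
  coker_pi colim_rel \o dsum_in x.

Lemma colim_in_nat x y (f : hom x y) a : colim_in y (fmap F f a) = colim_in x a.
Proof.
suff /coker_pi_eq0 h : exists b, colim_rel b = dsum_in y (fmap F f a) - dsum_in x a.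
  by apply/eqP; rewrite -subr_eq0; move: h; rewrite raddfB => /eqP.
exists (dsum_in (existT _ x (existT _ y f) : arrow) a).
by rewrite dsum_rec_in.
Qed.

Lemma colim_ext (A : zmodType) (g h : {additive colim -> A}) :
  (forall x a, g (colim_in x a) = h (colim_in x a)) -> g =1 h.
Proof.
move=> gh c; have [b <-] := coker_piP c.
exact: (@dsum_ext _ _ _ (g \o coker_pi colim_rel) (h \o coker_pi colim_rel)).
Qed.

Section Rec.
Variables (A : zmodType) (g : forall x, {additive F x -> A}).
Hypothesis g_nat : forall x y (f : hom x y) a, g y (fmap F f a) = g x a.

Fact colim_rec_subproof u : dsum_rec g (colim_rel u) = 0.
Proof.
apply: (@dsum_ext _ _ _ (dsum_rec g \o colim_rel) \0) => {}u a /=.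
rewrite -[LHS]/(dsum_rec g (dsum_rec _ (dsum_in u a))) dsum_rec_in /=.
by rewrite -[LHS]/(dsum_rec g _) raddfB !dsum_rec_in g_nat subrr.
Qed.

Definition colim_rec : {additive colim -> A} := coker_rec colim_rec_subproof.

Lemma colim_rec_in x a : colim_rec (colim_in x a) = g x a.
Proof. by rewrite coker_recE dsum_rec_in. Qed.

End Rec.
End Colimit.

Section ColimitMap.
Variables (C : category) (F G : functor C) (eta : nat_trans F G).

Fact colim_map_subproof x y (f : hom x y) a :
  (colim_in G y \o eta y) (fmap F f a) = (colim_in G x \o eta x) a.
Proof.
by rewrite -[LHS]/(colim_in G y (eta y _)) ntr_nat colim_in_nat.
Qed.

Definition colim_map : {additive colim F -> colim G} :=
  colim_rec colim_map_subproof.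

Lemma colim_map_in x a : colim_map (colim_in F x a) = colim_in G x (eta x a).
Proof. exact: colim_rec_in. Qed.

End ColimitMap.

Section Projective.
Variable C : category.
Implicit Types F G H P : functor C.

(* The category of functors to abelian groups is abelian with pointwise kernels
   and cokernels, so epimorphisms and exactness are tested pointwise. *)
Definition epi G H (p : nat_trans G H) : Prop :=
  forall x b, exists a, p x a = b.

Definition projective P : Prop :=
  forall G H (p : nat_trans G H) (q : nat_trans P H), epi p ->
  exists l : nat_trans P G, forall x a, p x (l x a) = q x a.

Definition exact_at F G H (d : nat_trans F G) (d' : nat_trans G H) : Prop :=
  forall x b, d' x b = 0 <-> exists a, d x a = b.

Record resolution F := Resolution {
  res :> nat -> functor C;
  res_proj : forall n, projective (res n);
  res_diff : forall n, nat_trans (res n.+1) (res n);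
  res_aug : nat_trans (res 0) F;
  res_epi : epi res_aug;
  res_exact0 : exact_at (res_diff 0) res_aug;
  res_exactS : forall n, exact_at (res_diff n.+1) (res_diff n)
}.

Section ColimitComplex.
Variables (F : functor C) (P : resolution F).

Fact colim_complex_diffK n c :
  colim_map (res_diff P n) (colim_map (res_diff P n.+1) c) = 0.
Proof.
apply: (@colim_ext _ _ _
  (colim_map (res_diff P n) \o colim_map (res_diff P n.+1)) \0) => {c} x a.
rewrite -[LHS]/(colim_map _ (colim_map _ _)) -[RHS]/0 !colim_map_in.
have /res_exactS -> : exists b, res_diff P n.+1 x b = res_diff P n.+1 x a.
  by exists a.
by rewrite raddf0.
Qed.

Definition colim_complex : chain_complex :=
  ChainComplex colim_complex_diffK.

End ColimitComplex.

Section KernelFunctor.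
Variables (G F : functor C) (eta : nat_trans G F).

Fact ker_fmap_subproof x y (f : hom x y) (a : ker (eta x)) :
  eta y ((fmap G f \o @ker_val _ _ (eta x)) a) = 0.
Proof. by rewrite /= ntr_nat kerP raddf0. Qed.

Definition ker_fmap x y (f : hom x y) : {additive ker (eta x) -> ker (eta y)} :=
  ker_lift (@ker_fmap_subproof x y f).

Fact ker_fmap1 x a : ker_fmap (idm x) a = a.
Proof. by apply: val_inj; rewrite /= fmap1. Qed.

Fact ker_fmap_comp x y z (f : hom x y) (g : hom y z) a :
  ker_fmap (mcomp f g) a = ker_fmap g (ker_fmap f a).
Proof. by apply: val_inj; rewrite /= fmap_comp. Qed.

Definition ker_functor : functor C := Functor ker_fmap1 ker_fmap_comp.

End KernelFunctor.

Section FreeFunctor.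
Variable F : functor C.

(* The direct sum, over all [c] and [a : F c], of the functors Z[hom c -]. *)
Definition free_basis (x : C) : choiceType := {c : C & (F c * hom c x)%type}.

Definition free_elt x c (a : F c) (h : hom c x) : free_basis x :=
  existT _ c (a, h).

Definition free_fob x : zmodType := dsum (fun _ : free_basis x => int : zmodType).

Definition free_in x (b : free_basis x) : {additive int -> free_fob x} :=
  @dsum_in _ (fun _ : free_basis x => int : zmodType) b.

Definition free_push x y (f : hom x y) (b : free_basis x) : free_basis y :=
  free_elt (tagged b).1 (mcomp (tagged b).2 f).

Definition free_fmap x y (f : hom x y) : {additive free_fob x -> free_fob y} :=
  dsum_rec (fun b => free_in (free_push f b)).

Lemma free_fmap_in x y (f : hom x y) b z :
  free_fmap f (free_in b z) = free_in (free_push f b) z.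
Proof. by rewrite [LHS]dsum_rec_in. Qed.

Lemma free_ext x (A : zmodType) (g h : {additive free_fob x -> A}) :
  (forall c (a : F c) (u : hom c x),
     g (free_in (free_elt a u) 1) = h (free_in (free_elt a u) 1)) -> g =1 h.
Proof.
move=> gh; apply: dsum_ext => -[c [a u]] z.
rewrite -[dsum_in _ _]/(free_in (free_elt a u) z) -[z]intz.
by rewrite !raddfMz gh.
Qed.

Fact free_fmap1 x a : free_fmap (idm x) a = a.
Proof.
apply: (@free_ext _ _ _ idfun) => c u h.
by rewrite free_fmap_in /free_push /= compm1.
Qed.

Fact free_fmap_comp x y z (f : hom x y) (g : hom y z) a :
  free_fmap (mcomp f g) a = free_fmap g (free_fmap f a).
Proof.
apply: (@free_ext _ _ _ (free_fmap g \o free_fmap f)) => c u h.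
rewrite -[RHS]/(free_fmap g (free_fmap f _)).
by rewrite !free_fmap_in /free_push /= compA.
Qed.

Definition free_functor : functor C := Functor free_fmap1 free_fmap_comp.

Definition int_map (A : zmodType) (a : A) : {additive int -> A} :=
  addmap (mulrzBr a).

Section Lift.
Variables (G : functor C) (g : forall c, F c -> G c).

Definition free_lift_fun x : {additive free_functor x -> G x} :=
  dsum_rec (fun b : free_basis x =>
              int_map (fmap G (tagged b).2 (g (tagged b).1))).

Lemma free_lift_in x c (a : F c) (h : hom c x) :
  free_lift_fun x (free_in (free_elt a h) 1) = fmap G h (g a).
Proof. by rewrite [LHS]dsum_rec_in. Qed.

Fact free_lift_nat x y (f : hom x y) a :
  free_lift_fun y (fmap free_functor f a) = fmap G f (free_lift_fun x a).
Proof.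
pose l : {additive free_fob x -> G y} := free_lift_fun y \o free_fmap f.
pose r : {additive free_fob x -> G y} := fmap G f \o free_lift_fun x.
apply: (@free_ext x _ l r) => c u h.
rewrite -[LHS]/(free_lift_fun y (free_fmap f _)).
rewrite -[RHS]/(fmap G f (free_lift_fun x _)).
by rewrite free_fmap_in !free_lift_in fmap_comp.
Qed.

Definition free_lift : nat_trans free_functor G := NatTrans free_lift_nat.

End Lift.

Definition free_aug : nat_trans free_functor F := free_lift (fun c => id).

Lemma free_aug_epi : epi free_aug.
Proof.
move=> x a; exists (free_in (free_elt a (idm x)) 1).
by rewrite free_lift_in fmap1.
Qed.

Lemma free_projective : projective free_functor.
Proof.
move=> G H p q p_epi.
pose e c (a : F c) := free_in (free_elt a (idm c)) 1.
pose g c (a : F c) := sval (cid (p_epi c (q c (e c a)))).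
have gP c a : p c (g c a) = q c (e c a) by rewrite /g; case: cid.
exists (free_lift g) => x b.
apply: (@free_ext _ _ (p x \o free_lift g x) (q x)) => c a h.
rewrite -[LHS]/(p x (free_lift_fun _ x _)) free_lift_in ntr_nat gP -ntr_nat.
by rewrite [fmap _ _ _]free_fmap_in /free_push /= comp1m.
Qed.

End FreeFunctor.

Section StandardResolution.
Variable F : functor C.

Fixpoint syzygy n : functor C :=
  if n is m.+1 then ker_functor (free_aug (syzygy m)) else F.

Definition std_diff_fun n x :
    {additive free_functor (syzygy n.+1) x -> free_functor (syzygy n) x} :=
  @ker_val _ _ (free_aug (syzygy n) x) \o free_aug (syzygy n.+1) x.

Fact std_diff_nat n x y (f : hom x y) a :
  std_diff_fun n y (fmap _ f a) = fmap _ f (std_diff_fun n x a).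
Proof.
by rewrite -[LHS]/(val (free_aug (syzygy n.+1) y (fmap _ f a))) ntr_nat.
Qed.

Definition std_diff n : nat_trans (free_functor (syzygy n.+1))
                                  (free_functor (syzygy n)) :=
  NatTrans (@std_diff_nat n).

Fact std_exact n : exact_at (std_diff n) (free_aug (syzygy n)).
Proof.
move=> x b; split=> [b0|[a <-]]; last exact: kerP.
have kb : kerf (free_aug (syzygy n) x) b by exact/eqP.
have [a ab] := @free_aug_epi (syzygy n.+1) x (exist _ b kb).
exists a; rewrite -[LHS]/(val (free_aug (syzygy n.+1) x a)).
by rewrite ab.
Qed.

Fact std_exactS n : exact_at (std_diff n.+1) (std_diff n).
Proof.
move=> x b; rewrite -std_exact; split=> [h|h]; first exact: val_inj.
by rewrite -[LHS]/(val (free_aug (syzygy n.+1) x b)) h.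
Qed.

Definition std_resolution : resolution F :=
  Resolution (fun n => @free_projective (syzygy n))
             (@free_aug_epi F) (@std_exact 0) std_exactS.

End StandardResolution.

(* A left derived functor does not depend, up to isomorphism, on the projective
   resolution that computes it; the standard free one is used here. *)
Definition derived_colim (n : nat) (F : functor C) : zmodType :=
  homology (colim_complex (std_resolution F)) n.

End Projective.

Section TraceMonoid.
Variables (E : choiceType) (I : rel E).

Inductive trace_equiv : seq E -> seq E -> Prop :=
| trace_swap u v a b of I a b :
    trace_equiv (u ++ a :: b :: v) (u ++ b :: a :: v)
| trace_refl u : trace_equiv u u
| trace_sym u v of trace_equiv u v : trace_equiv v u
| trace_trans u v w of trace_equiv u v & trace_equiv v w : trace_equiv u w.

Definition trace_eqb : rel (seq E) := fun u v => `[< trace_equiv u v >].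

Fact trace_eqb_class : equiv_class_of trace_eqb.
Proof.
split=> [u|u v|v u w]; first exact/asboolP/trace_refl.
  by apply/asboolP/asboolP; exact: trace_sym.
by move=> /asboolP uv /asboolP vw; exact/asboolP/(trace_trans uv vw).
Qed.

Canonical trace_equiv_rel := EquivRelPack trace_eqb_class.
Canonical trace_enc_rel := defaultEncModRel trace_eqb.

Definition trace_monoid := {eq_quot trace_eqb}.
HB.instance Definition _ := Choice.on trace_monoid.

Definition trace (u : seq E) : trace_monoid := \pi_trace_monoid u.

Definition generator (a : E) : trace_monoid := trace [:: a].

Lemma trace_eq u v : trace u = trace v <-> trace_equiv u v.
Proof. by split=> [/eqmodP/asboolP|uv] //; apply/eqmodP/asboolP. Qed.

Lemma trace_ind (P : trace_monoid -> Prop) :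
  (forall u, P (trace u)) -> forall w, P w.
Proof. by move=> PT w; rewrite -[w]reprK; exact: PT. Qed.

Definition trace_mul (v w : trace_monoid) : trace_monoid :=
  trace (repr v ++ repr w).

Lemma trace_cat_equiv u u' v v' :
  trace_equiv u u' -> trace_equiv v v' -> trace_equiv (u ++ v) (u' ++ v').
Proof.
move=> uu' vv'; apply: (@trace_trans _ (u' ++ v)).
  elim: uu' => {u u'} [u w a b ab|u|u w _|u w z _ IH1 _ IH2].
  - by rewrite -!catA; exact: trace_swap.
  - exact: trace_refl.
  - exact: trace_sym.
  - exact: trace_trans IH1 IH2.
elim: vv' => {v v'} [v w a b ab|v|v w _|v w z _ IH1 _ IH2].
- by rewrite !catA; exact: trace_swap.
- exact: trace_refl.
- exact: trace_sym.
- exact: trace_trans IH1 IH2.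
Qed.

Lemma trace_cat u v : trace_mul (trace u) (trace v) = trace (u ++ v).
Proof. by apply/trace_eq/trace_cat_equiv; apply/trace_eq; exact: reprK. Qed.

Fact trace_mulA : associative trace_mul.
Proof.
elim/trace_ind=> u; elim/trace_ind=> v; elim/trace_ind=> w.
by rewrite !trace_cat catA.
Qed.

Fact trace_mul1 : left_id (trace [::]) trace_mul.
Proof. by elim/trace_ind=> u; rewrite trace_cat. Qed.

Fact trace_mulr1 : right_id (trace [::]) trace_mul.
Proof. by elim/trace_ind=> u; rewrite trace_cat cats0. Qed.

HB.instance Definition _ :=
  isMonoid.Build trace_monoid trace_mulA trace_mul1 trace_mulr1.

Lemma generatorC a b :
  I a b -> (generator a * generator b = generator b * generator a)%g.
Proof.
move=> ab.
have gE c d : (generator c * generator d)%g = trace [:: c; d].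
  exact: trace_cat.
by rewrite !gE; apply/trace_eq; exact: (@trace_swap [::] [::]).
Qed.

End TraceMonoid.
Arguments trace {E} I u.
Arguments generator {E} I a.

(* A partial map is encoded by [None] outside its domain; [obind] makes
   [act s (v * w)] defined exactly when [act s v] and then [act _ w] are. *)
Record partial_action (M : monoidType) (S : choiceType) := PartialAction {
  act :> S -> M -> option S;
  act1 : forall s, act s 1%g = Some s;
  actM : forall s v w, act s (v * w)%g = obind (act^~ w) (act s v)
}.

Section StateCategory.
Variables (M : monoidType) (S : choiceType) (X : partial_action M S).

(* [option S] is S together with the point [*], represented by [None]. *)
Definition act_star (x : option S) (w : M) : option S := obind (X^~ w) x.

Lemma act_star1 x : act_star x 1%g = x.
Proof. by case: x => //= s; rewrite act1. Qed.

Lemma act_starM x v w : act_star x (v * w)%g = act_star (act_star x v) w.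
Proof. by case: x => //= s; rewrite actM. Qed.

Definition state_hom (x y : option S) : choiceType :=
  {w : M | act_star x w == y}.

Definition state_mor x (w : M) : state_hom x (act_star x w) :=
  exist _ w (eqxx _).

Definition state_idm x : state_hom x x :=
  exist (fun w => act_star x w == x) 1%g (introT eqP (act_star1 x)).

Fact state_comp_subproof x y z (f : state_hom x y) (g : state_hom y z) :
  act_star x (val f * val g)%g == z.
Proof. by rewrite act_starM (eqP (valP f)) (valP g). Qed.

Definition state_comp x y z (f : state_hom x y) (g : state_hom y z) :
    state_hom x z :=
  exist (fun w => act_star x w == z) (val f * val g)%g
        (state_comp_subproof f g).

Definition augmented_state_category : category.
Proof.
apply: (@Category (option S) state_hom state_idm state_comp).
- by move=> *; apply: val_inj; rewrite /= mulgA.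
- by move=> *; apply: val_inj; rewrite /= mul1g.
- by move=> *; apply: val_inj; rewrite /= mulg1.
Defined.

End StateCategory.

Section CliqueComplex.
Variables (d : Order.disp_t) (E : orderType d) (I : rel E) (S : choiceType).
Variables (X : partial_action (trace_monoid I) S).
Variable F : functor (augmented_state_category X).

Definition clique_rel : rel E := fun a b => (a < b)%O && I a b.

Definition clique n := {t : n.-tuple E | pairwise clique_rel t}.

Definition Qn n : choiceType := (option S * clique n)%type.

Definition Qsum n : zmodType := dsum (fun q : Qn n => F q.1).

Definition Qin n x (t : clique n) : {additive F x -> Qsum n} :=
  @dsum_in (Qn n) (fun q => F q.1) (x, t).

Lemma clique_lt n (t : clique n) (i j : 'I_n) :
  (i < j)%N -> clique_rel (tnth (val t) i) (tnth (val t) j).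
Proof.
move=> ij; have x0 := tnth (val t) i; rewrite !(tnth_nth x0).
by apply: (pairwiseP x0 (valP t)); rewrite ?inE ?size_tuple.
Qed.

Definition omit_tuple n (s : 'I_n.+1) (t : n.+1.-tuple E) : n.-tuple E :=
  [tuple tnth t (lift s j) | j < n].

Fact omit_subproof n (s : 'I_n.+1) (t : clique n.+1) :
  pairwise clique_rel (omit_tuple s (val t)).
Proof.
rewrite pairwise_map; apply: (@sub_pairwise _ (relpre val ltn)) => [i j ij|].
  apply: clique_lt; rewrite /= /bump.
  by move: ij => /=; lia.
by rewrite -pairwise_map val_enum_ord -sorted_pairwise ?iota_ltn_sorted //; apply: ltn_trans.
Qed.

Definition omit n (s : 'I_n.+1) (t : clique n.+1) : clique n :=
  exist (fun u : n.-tuple E => pairwise clique_rel u) _ (omit_subproof s t).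

(* [Qface s (x, t) f] is (x.a, omit s t, F(x -> x.a) f) - (x, omit s t, f), for
   [a] the entry of index [s] of [t]. *)
Definition Qface n (s : 'I_n.+1) (q : Qn n.+1) : {additive F q.1 -> Qsum n} :=
  let a := generator I (tnth (val q.2) s) in
  (Qin (act_star X q.1 a) (omit s q.2) \o fmap F (state_mor X q.1 a))
  \- Qin q.1 (omit s q.2).

(* Indices [s : 'I_n.+1] start at 0, hence the exponent [s.+1]. *)
Definition Qdiff_fun n (q : Qn n.+1) (f : F q.1) : Qsum n :=
  \sum_(s < n.+1) Qface s q f *~ (-1) ^+ s.+1.

Fact Qdiff_zmod n (q : Qn n.+1) : zmod_morphism (@Qdiff_fun n q).
Proof.
move=> f g; rewrite -sumrB; apply: eq_bigr => s _.
by rewrite raddfB mulrzBl.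
Qed.

Definition Qdiff n : {additive Qsum n.+1 -> Qsum n} :=
  dsum_rec (fun q => addmap (@Qdiff_zmod n q)).

Lemma Qdiff_in n x (t : clique n.+1) f :
  Qdiff n (Qin x t f) = \sum_(s < n.+1) Qface s (x, t) f *~ (-1) ^+ s.+1.
Proof.
exact: (@dsum_rec_in (Qn n.+1) (fun q => F q.1) _
         (fun q => addmap (@Qdiff_zmod n q)) (x, t) f).
Qed.

Section DiffDiff.
Variables (x : option S) (f : F x).

Let cell m w (t : clique m) : Qsum m :=
  Qin (act_star X x w) t (fmap F (state_mor X x w) f).

Lemma Qin_cell m y (h : state_hom X x y) (t : clique m) :
  Qin y t (fmap F (h : hom (x : augmented_state_category X) y) f) = cell (val h) t.
Proof.
case: h => w p; move: (p); rewrite -(eqP p) => q.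
by rewrite /cell /state_mor (bool_irrelevance q (eqxx _)).
Qed.

Lemma Qface_cell m w (s : 'I_m.+1) (t : clique m.+1) :
  Qface s (act_star X x w, t) (fmap F (state_mor X x w) f) =
  cell (w * generator I (tnth (val t) s))%g (omit s t) - cell w (omit s t).
Proof.
congr (_ - _); rewrite -[RHS](@Qin_cell _ _
  (state_comp (state_mor X x w) (state_mor X _ (generator I _)))).
by rewrite [fmap F (state_comp _ _) f]fmap_comp.
Qed.

Lemma Qdiff_cell m w (t : clique m.+1) :
  Qdiff m (cell w t) =
  \sum_(s < m.+1) (cell (w * generator I (tnth (val t) s))%g (omit s t)
                   - cell w (omit s t)) *~ (-1) ^+ s.+1.
Proof. by rewrite Qdiff_in; apply: eq_bigr => s _; rewrite Qface_cell. Qed.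

Lemma Qin_cell1 m (t : clique m) : Qin x t f = cell 1%g t.
Proof.
rewrite -[RHS](@Qin_cell _ _ (state_idm X x)); congr (Qin x t _).
by rewrite [RHS](@fmap1 (augmented_state_category X)).
Qed.

Let cell2 n w (s : 'I_n.+2) (r : 'I_n.+1) (t : clique n.+2) : Qsum n :=
  let a := generator I (tnth (val t) s) in
  let b := generator I (tnth (val t) (lift s r)) in
  let u := omit r (omit s t) in
  cell (w * (a * b))%g u - cell (w * a)%g u - (cell (w * b)%g u - cell w u).

Let cell2_sgn n w (t : clique n.+2) (s r : 'I_n.+2) : Qsum n :=
  if unlift s r is Some r' then
    cell2 w s r' t *~ ((-1) ^+ s.+1 * (-1) ^+ r'.+1)
  else 0.

Lemma cell2_sgn_lt n w (t : clique n.+2) (s r : 'I_n.+2) :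
  (s < r)%N -> cell2_sgn w t s r = - cell2_sgn w t r s.
Proof.
move=> sr; have srN : s != r by rewrite -val_eqE /= neq_ltn sr.
rewrite /cell2_sgn; case: unliftP => [r'|] er; last by rewrite er eqxx in srN.
subst r.
case: unliftP => [s'|] es'; last by rewrite -es' eqxx in srN.
have vs : val s = bump (bump s r') s' by rewrite [in LHS]es'.
have [vs' sr'] : (s' = s :> nat /\ s <= r')%N.
  by move: sr vs => /=; rewrite /bump; lia.
have eu : omit s' (omit (lift s r') t) = omit r' (omit s t).
  apply/val_inj/eq_from_tnth => j; rewrite !tnth_mktuple; congr tnth.
  by apply/val_inj; rewrite /= vs' [RHS]bumpC /unbump ltnNge sr' subn0.
rewrite /cell2 -es' eu.
have ab : clique_rel (tnth (val t) s) (tnth (val t) (lift s r')).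
  exact: clique_lt.
have /generatorC -> : I (tnth (val t) s) (tnth (val t) (lift s r')).
  by case/andP: ab.
rewrite -mulrNz; congr (_ *~ _).
  by rewrite !opprB [LHS]addrACA [RHS]addrACA [X in _ + X = _]addrC.
rewrite /= vs' /bump sr' add1n !exprS; ring.
Qed.

Lemma cell2_sgnN n w (t : clique n.+2) (s r : 'I_n.+2) :
  cell2_sgn w t s r = - cell2_sgn w t r s.
Proof.
have [sr|rs|/val_inj ->] := ltngtP s r; first exact: cell2_sgn_lt.
  by rewrite (cell2_sgn_lt _ _ rs) opprK.
by rewrite /cell2_sgn; case: unliftP => [r' /eqP|_]; rewrite ?oppr0 // (negPf (neq_lift _ _)).
Qed.

Lemma sum_antisym (A : zmodType) m (W : 'I_m -> 'I_m -> A) :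
  (forall i, W i i = 0) -> (forall i j, W i j = - W j i) ->
  \sum_(i < m) \sum_(j < m) W i j = 0.
Proof.
elim: m W => [|m IH] W W0 WN; first by rewrite big_ord0.
rewrite big_ord_recl big_ord_recl W0 add0r.
under [X in _ + X]eq_bigr => i _ do rewrite big_ord_recl.
rewrite big_split /= (IH (fun i j => W (lift ord0 i) (lift ord0 j))) ?addr0 //.
by rewrite -big_split /= big1 // => i _; rewrite [W ord0 _]WN addNr.
Qed.

Lemma Qdiff_diff_cell n w (t : clique n.+2) :
  Qdiff n (Qdiff n.+1 (cell w t)) = 0.
Proof.
have W0 s : cell2_sgn w t s s = 0 by rewrite /cell2_sgn unlift_none.
rewrite Qdiff_cell raddf_sum.
rewrite -[RHS](sum_antisym W0 (@cell2_sgnN n w t)).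
apply: eq_bigr => s _; rewrite [RHS](bigD1_ord s) //= W0 add0r.
rewrite -[LHS]/(Qdiff n _) raddfMz raddfB !Qdiff_cell -sumrB mulrz_suml.
apply: eq_bigr => r _; rewrite /cell2_sgn liftK /cell2 tnth_mktuple.
by rewrite -mulrzBl -mulrzA mulrC -mulgA.
Qed.

End DiffDiff.

Fact QdiffK n (c : Qsum n.+2) : Qdiff n (Qdiff n.+1 c) = 0.
Proof.
apply: (@dsum_ext _ _ _ (Qdiff n \o Qdiff n.+1) \0) => -[x t] f.
rewrite -[RHS]/0 -[LHS]/(Qdiff n (Qdiff n.+1 (Qin x t f))).
by rewrite Qin_cell1 Qdiff_diff_cell.
Qed.

Definition clique_complex : chain_complex := ChainComplex QdiffK.

End CliqueComplex.

(* Main.v *)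
From HB Require Import structures.
From mathcomp Require Import all_boot all_order all_algebra.
From mathcomp Require Import all_classical.
Require Import Defs.

(** Regard the direct sum of the groups F(x) as a right module over the monoid
ring Z[M] of the trace monoid M.  As every object x of the state category is
the source of exactly one morphism for each w in M, the derived functors of the
colimit are the groups Tor(-, Z) over Z[M], and the complex of the theorem is
this module tensored with a Koszul resolution of Z: free on the cliques, that
is on the increasing tuples of pairwise independent generators.  The proof
keeps this idea but never mentions modules over Z[M].

The heart is [free_clique_acyclic]: the clique complex of a free functor has no
homology in positive degrees.  It has a basis of cells (w, t), with w a trace
and t a clique, and the differential removes a letter a from t in two ways,
sending w to w a or to w.  The first way preserves the product z of w with the
letters of t.  For a fixed z the cells form a full simplex on the letters by
which z is divisible on the right, since these letters are pairwise
independent, and a simplex is contracted by adjoining a chosen vertex, here the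
least one.  This contraction [contract] is a homotopy to zero only up to the
terms of the second kind, but these have a shorter w; hence the error
[contract_defect] is locally nilpotent and every cycle is a boundary.  The
divisibility facts come from the partial operation [rquot], which divides a
trace on the right by a letter.

The rest is dimension shifting.  The clique complex is exact in the functor
([Qmap_exact] and its companions), and its homology in degree 0 is the colimit
([Qaug_exact]).  With K_m the m-th syzygy of F in its standard free resolution,
the exact sequences 0 -> K_(m+1) -> P_m -> K_m -> 0 and the acyclicity of P_m
identify the homology of degree m+1 of the clique complex of F with that of
degree 1 for K_m ([syzygy_homology_shift]), and a chase on the last corner
identifies the latter with the derived colimit ([derived_colimS_clique]). *)

Set Implicit Arguments.
Unset Strict Implicit.
Unset Printing Implicit Defensive.

Import Order.TTheory GRing.Theory.
Local Open Scope ring_scope.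

(** * Isomorphisms of homology groups from additive relations *)

Lemma zmod_isomorphic_trans (A B C : zmodType) :
  zmod_isomorphic A B -> zmod_isomorphic B C -> zmod_isomorphic A C.
Proof.
move=> [f fB] [g gB]; exists (g \o f); exact: bij_comp.
Qed.

(** Connecting homomorphisms and their inverses are multivalued at the level of
chains.  Treating them as additive relations between groups, with both
projections onto and both kernels trivial, makes their construction symmetric
and spares any choice of lifts of chains. *)
Lemma zmod_isomorphic_rel (A B : zmodType) (R : A -> B -> Prop) :
  (forall a a' b b', R a b -> R a' b' -> R (a - a') (b - b')) ->
  (forall a, exists b, R a b) -> (forall b, exists a, R a b) ->
  (forall a b, R a b -> a = 0 <-> b = 0) ->
  zmod_isomorphic A B.
Proof.
move=> RB Rl Rr R0.
pose f a := sval (cid (Rl a)); pose g b := sval (cid (Rr b)).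
have fR a : R a (f a) by rewrite /f; case: cid.
have gR b : R (g b) b by rewrite /g; case: cid.
have Rfun a b b' : R a b -> R a b' -> b = b'.
  move=> ab ab'; apply/eqP; rewrite -subr_eq0; apply/eqP.
  by have /R0 [+ _] := RB _ _ _ _ ab ab'; rewrite subrr; apply.
have Rinj a a' b : R a b -> R a' b -> a = a'.
  move=> ab ab'; apply/eqP; rewrite -subr_eq0; apply/eqP.
  by have /R0 [_ +] := RB _ _ _ _ ab ab'; rewrite subrr; apply.
have fB : zmod_morphism f by move=> a a'; apply: Rfun (fR _) _; exact: RB.
exists (addmap fB); exists g => [a|b] /=; first exact: Rinj (gR _) (fR _).
exact: Rfun (fR _) (gR _).
Qed.

Section Representatives.
Variable C : chain_complex.

Definition is_cycle n : C n -> Prop :=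
  if n is m.+1 then fun c => diff C m c = 0 else fun=> True.

Definition is_boundary n (c : C n) : Prop := exists b, diff C n b = c.

(** The homology in degree 0 is a cokernel, in higher degrees a cokernel on a
kernel; this relation between chains and classes hides the distinction. *)
Definition represents n : C n -> homology C n -> Prop :=
  match n with
  | 0 => fun c h => coker_pi (diff C 0) c = h
  | m.+1 => fun c h => exists2 k : ker (diff C m),
      val k = c & coker_pi (ker_lift (@diffK C m)) k = h
  end.

Lemma representsB n (c c' : C n) h h' :
  represents c h -> represents c' h' -> represents (c - c') (h - h').
Proof.
case: n c c' h h' => [|n] c c' h h' /=; first by move=> <- <-; rewrite raddfB.
move=> [k <- <-] [k' <- <-]; exists (k - k').
  exact: (raddfB (@ker_val _ _ (diff C n))).
exact: raddfB.
Qed.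

Lemma cycle_represents n (c : C n) : is_cycle c -> exists h, represents c h.
Proof.
case: n c => [|n] c /= c0; first by exists (coker_pi (diff C 0) c).
have kc : kerf (diff C n) c by exact/eqP.
by eexists; exists (exist _ c kc : ker (diff C n)).
Qed.

Lemma represents_surj n (h : homology C n) :
  exists2 c, is_cycle c & represents c h.
Proof.
case: n h => [|n] h; have [c <-] := coker_piP h; first by exists c.
by exists (val c); [exact: kerP | exists c].
Qed.

Lemma represents_eq0 n (c : C n) h : represents c h -> h = 0 <-> is_boundary c.
Proof.
case: n c h => [|n] c h /=; first by move=> <-; exact: coker_pi_eq0.
move=> [k <- <-]; rewrite coker_pi_eq0; split=> [[b <-]|[b bk]]; exists b => //.
exact: val_inj.
Qed.

End Representatives.

(** The two complexes and the two degrees are independent, so that the lemma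
serves both for comparing complexes and for dimension shifts. *)
Lemma homology_isomorphic_rel (C D : chain_complex) n m
    (R : C n -> D m -> Prop) :
  (forall c c' e e', R c e -> R c' e' -> R (c - c') (e - e')) ->
  (forall c, is_cycle c -> exists2 e, is_cycle e & R c e) ->
  (forall e, is_cycle e -> exists2 c, is_cycle c & R c e) ->
  (forall c e, R c e -> is_boundary c <-> is_boundary e) ->
  zmod_isomorphic (homology C n) (homology D m).
Proof.
move=> RB Rl Rr R0.
apply: (@zmod_isomorphic_rel _ _
  (fun h k => exists c e, [/\ represents c h, represents e k & R c e])).
- move=> h h' k k' [c [e [ch ek ce]]] [c' [e' [ch' ek' ce']]].
  exists (c - c'), (e - e'); split; [exact: representsB..|exact: RB].
- move=> h; have [c cC ch] := represents_surj h.
  have [e /cycle_represents [k ek] ce] := Rl c cC.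
  by exists k, c, e.
- move=> k; have [e eC ek] := represents_surj k.
  have [c /cycle_represents [h ch] ce] := Rr e eC.
  by exists h, c, e.
- move=> h k [c [e [/represents_eq0 -> /represents_eq0 -> /R0]]]; exact.
Qed.

(** * Exactness of direct sums *)

Section DirectSumMap.
Variable I : choiceType.

Lemma dsum_ind (A : I -> zmodType) (P : dsum A -> Prop) :
  P 0 -> (forall u v, P u -> P v -> P (u + v)) ->
  (forall i a, P (dsum_in i a)) -> forall u, P u.
Proof.
move=> P0 PD Pin u; have [r ur fr] := dsum_suppP u.
by rewrite (dsum_decomp ur fr); elim/big_ind: _ => //.
Qed.

Variables A B : I -> zmodType.

Definition dsum_map (g : forall i, {additive A i -> B i}) :
  {additive dsum A -> dsum B} := dsum_rec (fun i => dsum_in i \o g i).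

Lemma dsum_map_in g i a : dsum_map g (dsum_in i a) = dsum_in i (g i a).
Proof. exact: dsum_rec_in. Qed.

Lemma dsum_addE (u v : dsum A) i : val (u + v) i = val u i + val v i.
Proof. by []. Qed.

End DirectSumMap.

Lemma dsum_mapE (I : choiceType) (A B : I -> zmodType)
    (g : forall i, {additive A i -> B i}) (u : dsum A) i :
  val (dsum_map g u) i = g i (val u i).
Proof.
elim/dsum_ind: u => [|u v IHu IHv|j a].
- by rewrite raddf0 [RHS](raddf0 (g i)).
- by rewrite raddfD dsum_addE IHu IHv dsum_addE raddfD.
rewrite dsum_map_in /=; have [<-|ij] := eqVneq j i.
  by rewrite !dsum_in_fun_id.
by rewrite !dsum_in_fun_neq // raddf0.
Qed.

Lemma dsum_map_surj (I : choiceType) (A B : I -> zmodType)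
    (g : forall i, {additive A i -> B i}) :
  (forall i b, exists a, g i a = b) -> forall v, exists u, dsum_map g u = v.
Proof.
move=> gs; elim/dsum_ind=> [|v v' [u <-] [u' <-]|i b].
- by exists 0; rewrite raddf0.
- by exists (u + u'); rewrite raddfD.
- by have [a <-] := gs i b; exists (dsum_in i a); rewrite dsum_map_in.
Qed.

Lemma dsum_map_exact (I : choiceType) (A B C : I -> zmodType)
    (f : forall i, {additive A i -> B i})
    (g : forall i, {additive B i -> C i}) :
  (forall i b, g i b = 0 -> exists a, f i a = b) ->
  forall v, dsum_map g v = 0 -> exists u, dsum_map f u = v.
Proof.
move=> fg v gv; have [r ur vr] := dsum_suppP v.
rewrite (dsum_decomp ur vr).
elim/big_ind: _ => [|_ _ [u <-] [u' <-]|i _].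
- by exists 0; rewrite raddf0.
- by exists (u + u'); rewrite raddfD.
have [|a <-] := fg i (val v i); first by rewrite -dsum_mapE gv.
by exists (dsum_in i a); rewrite dsum_map_in.
Qed.

Lemma dsum_map_inj (I : choiceType) (A B : I -> zmodType)
    (g : forall i, {additive A i -> B i}) :
  (forall i, injective (g i)) -> injective (dsum_map g).
Proof.
by move=> gi u v uv; apply: dsumP => i; apply: (gi i); rewrite -!dsum_mapE uv.
Qed.

(** * Right division by a letter in a trace monoid *)

Section TraceDivision.
Variables (E : choiceType) (I : rel E).
Hypotheses (I_irrefl : irreflexive I) (I_sym : symmetric I).
Notation M := (trace_monoid I).

(** A family of self-maps of [T], commuting for independent letters, is an
action of the trace monoid.  Length and division below are obtained from such
actions, without normal forms. *)
Lemma foldl_trace_equiv (T : Type) (step : T -> E -> T) :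
  (forall s a b, I a b -> step (step s a) b = step (step s b) a) ->
  forall u v, trace_equiv I u v -> forall s, foldl step s u = foldl step s v.
Proof.
move=> stepC u v; elim=> {u v} [u v a b ab|//|u v _ IH|u v w _ IH1 _ IH2] s.
- by rewrite !foldl_cat /= stepC.
- by rewrite IH.
- by rewrite IH1 IH2.
Qed.

Lemma trace_rcons u a : trace I (rcons u a) = (trace I u * generator I a)%g.
Proof. by rewrite -cats1 -trace_cat. Qed.

Lemma trace_rcons_ind (P : M -> Prop) :
  P 1%g -> (forall w a, P w -> P (w * generator I a)%g) -> forall w, P w.
Proof.
move=> P1 PM; elim/trace_ind; elim/last_ind=> [|u a IH]; first exact: P1.
by rewrite trace_rcons; exact: PM.
Qed.

Definition trace_length (w : M) : nat := foldl (fun k _ => k.+1) 0 (repr w).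

Lemma trace_lengthM w a :
  trace_length (w * generator I a)%g = (trace_length w).+1.
Proof.
have lenE u : trace_length (trace I u) = foldl (fun k _ => k.+1) 0 u.
  apply: foldl_trace_equiv => //; apply/trace_eq; exact: reprK.
by elim/trace_ind: w => u; rewrite -trace_rcons !lenE foldl_rcons.
Qed.

(** The state is a trace together with its quotient by [c].  When a letter [x]
is appended, the quotient becomes the old trace if [x] is [c]; otherwise [c]
stays a right divisor only if it commutes past [x]. *)
Definition division_step (c : E) (s : M * option M) (x : E) : M * option M :=
  ((s.1 * generator I x)%g,
   if x == c then Some s.1
   else if I c x then omap (fun w => w * generator I x)%g s.2 else None).

Definition rquot (c : E) (w : M) : option M :=
  (foldl (division_step c) (1%g, None) (repr w)).2.

Lemma division_stepC c s a b : I a b ->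
  division_step c (division_step c s a) b =
  division_step c (division_step c s b) a.
Proof.
move=> ab; have abN : a != b by apply: contraTneq ab => ->; rewrite I_irrefl.
case: s => w o; rewrite /division_step /= -!mulgA (generatorC ab).
congr (_, _); have [ac|ac] := eqVneq a c; have [bc|bc] := eqVneq b c.
- by rewrite ac bc eqxx in abN.
- by rewrite -ac ab.
- by rewrite -bc I_sym ab.
case: (I c a); case: (I c b); case: o => //= v.
by rewrite -!mulgA (generatorC ab).
Qed.

Lemma foldl_division c u :
  foldl (division_step c) (1%g, None) u = (trace I u, rquot c (trace I u)).
Proof.
have -> : rquot c (trace I u) = (foldl (division_step c) (1%g, None) u).2.
  congr snd; apply: foldl_trace_equiv; first exact: division_stepC.
  by apply/trace_eq; exact: reprK.
rewrite [LHS]surjective_pairing; congr (_, _).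
by elim/last_ind: u => // u x IH; rewrite foldl_rcons /= IH trace_rcons.
Qed.

Lemma rquot1 c : rquot c 1%g = None.
Proof. by have /(congr1 snd) := foldl_division c [::]. Qed.

(** This contains what is needed of cancellation in M: from [w x = v c] follows
[w = v] if [x] is [c], and otherwise that [x] and [c] are independent and that
[w] and [v] have a common left factor. *)
Lemma rquotM c w x : rquot c (w * generator I x)%g =
  if x == c then Some w
  else if I c x then omap (fun v => v * generator I x)%g (rquot c w) else None.
Proof.
elim/trace_ind: w => u.
have /(congr1 snd) := foldl_division c (rcons u x).
by rewrite foldl_rcons foldl_division /= trace_rcons => <-.
Qed.

Lemma rquotK c w v : rquot c w = Some v -> w = (v * generator I c)%g.
Proof.
elim/trace_rcons_ind: w v => [|w x IH] v; first by rewrite rquot1.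
rewrite rquotM; have [-> [->]|_] := eqVneq x c; first by [].
case: ifP => // cx; case: rquot IH => //= v' /(_ v' erefl) -> [<-].
by rewrite -!mulgA (generatorC cx).
Qed.

Lemma rquot_letter c u : rquot c (trace I u) != None -> c \in u.
Proof.
elim/last_ind: u => [|u x IH]; first by rewrite rquot1.
rewrite trace_rcons rquotM mem_rcons inE; case: (eqVneq x c) => //= _.
by case: ifP => // _; case: rquot IH => //= v /(_ isT) ->; rewrite orbT.
Qed.

End TraceDivision.

(** * Letters that can be moved from a trace to a clique *)

Section MinimalDivisor.
Variables (d : Order.disp_t) (E : orderType d) (I : rel E).
Hypotheses (I_irrefl : irreflexive I) (I_sym : symmetric I).
Notation M := (trace_monoid I).

Lemma seq_minimum (P : pred E) (s : seq E) : has P s ->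
  exists2 m, P m & forall c, c \in s -> P c -> (m <= c)%O.
Proof.
elim: s => //= x s IH; have [/IH [m Pm m_min] _|Ns] := boolP (has P s).
  have [Px|Px] := boolP (P x); last first.
    exists m => // c; rewrite inE => /predU1P[->|]; last exact: m_min.
    by move=> Px'; rewrite Px' in Px.
  have [xm|mx] := leP x m.
    exists x => // c; rewrite inE => /predU1P[->|cs Pc]; first by [].
    exact: le_trans xm (m_min c cs Pc).
  exists m => // c; rewrite inE => /predU1P[->|cs Pc]; first by rewrite ltW.
  exact: m_min.
rewrite orbF => Px; exists x => // c; rewrite inE => /predU1P[->//|cs Pc].
by move/hasPn: Ns => /(_ c cs); rewrite Pc.
Qed.

(** The letter [c] divides [w] on the right and can be put in front of the
clique [t]: the vertices of the simplex of [w] and [t] that precede those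
of [t]. *)
Definition extends n (w : M) (t : clique I n) (c : E) : bool :=
  (rquot c w != None) && all (clique_rel I c) (val t).

Definition minimal_extension n (w : M) (t : clique I n) (m : E) : Prop :=
  extends w t m /\ forall c, extends w t c -> (m <= c)%O.

(** The letters dividing a trace occur in every word for it, so they are
finitely many and a least one exists. *)
Lemma extension_cases n (w : M) (t : clique I n) :
  (exists m v (mt : all (clique_rel I m) (val t)),
     minimal_extension w t m /\ rquot m w = Some v) \/
  (forall c, ~~ extends w t c).
Proof.
have [[c ct]|no] := pselect (exists c, extends w t c); last first.
  by right=> c; apply/negP => ct; apply: no; exists c.
left; elim/trace_ind: w ct => u cu.
have letter b : extends (trace I u) t b -> b \in u.
  by case/andP=> /rquot_letter ->.
have [|m mu m_min] := @seq_minimum (extends (trace I u) t) u.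
  by apply/hasP; exists c => //; exact: letter.
have /andP[mw mt] := mu; case mv: (rquot m (trace I u)) mw => [v|] // _.
exists m, v, mt; split=> //; split=> // b bu; apply: m_min => //; exact: letter.
Qed.

Lemma minimal_extension_unique n (w : M) (t : clique I n) m m' :
  minimal_extension w t m -> minimal_extension w t m' -> m = m'.
Proof.
by move=> [mt m_min] [m't m'_min]; apply/le_anti; rewrite m_min ?m'_min.
Qed.

Fact cons_clique_subproof n m (t : clique I n) :
  all (clique_rel I m) (val t) -> pairwise (clique_rel I) [tuple of m :: val t].
Proof. by move=> mt; rewrite /= mt; exact: (valP t). Qed.

Definition cons_clique n m (t : clique I n)
    (mt : all (clique_rel I m) (val t)) : clique I n.+1 :=
  exist (fun u : n.+1.-tuple E => pairwise (clique_rel I) u) _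
    (cons_clique_subproof mt).

Lemma all_omit n (p : pred E) (s : 'I_n.+1) (t : clique I n.+1) :
  all p (val t) -> all p (val (omit s t)).
Proof.
move=> /all_tnthP pt; apply/all_tnthP => i; rewrite tnth_mktuple; exact: pt.
Qed.

Lemma omit_cons0 n m (t : clique I n) (mt : all (clique_rel I m) (val t)) :
  omit ord0 (cons_clique mt) = t.
Proof.
by apply/val_inj/eq_from_tnth => j; rewrite tnth_mktuple tnthS.
Qed.

Lemma omit_consS n m (t : clique I n.+1) (mt : all (clique_rel I m) (val t)) s :
  omit (lift ord0 s) (cons_clique mt) = cons_clique (all_omit s mt).
Proof.
apply/val_inj/eq_from_tnth => j; rewrite tnth_mktuple.
have [->|[j' ->]] : j = ord0 \/ exists j', j = lift ord0 j'.
  by have [j' ->|->] := unliftP ord0 j; [right; exists j'|left].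
  have -> : lift (lift ord0 s) ord0 = ord0 by apply: val_inj.
  by rewrite !tnth0.
have -> : lift (lift ord0 s) (lift ord0 j') = lift ord0 (lift s j').
  by apply: val_inj; rewrite /= /bump /= !add1n ltnS addnS.
by rewrite !tnthS tnth_mktuple.
Qed.

Lemma uncons_clique n (t : clique I n.+1) :
  exists m (t' : clique I n) (mt : all (clique_rel I m) (val t')),
    t = cons_clique mt.
Proof.
case: t => t; case/tupleP: t => m t' p.
have := p; rewrite /= => /andP[mt pt].
exists m, (exist (fun u : n.-tuple E => pairwise (clique_rel I) u) t' pt), mt.
by apply: val_inj; apply: val_inj.
Qed.

Lemma all_omitE n (p : pred E) (s : 'I_n.+1) (t : clique I n.+1) :
  all p (val t) = p (tnth (val t) s) && all p (val (omit s t)).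
Proof.
apply/idP/andP => [pt|[ps /all_tnthP pt]].
  by split; [move/all_tnthP: pt | exact: all_omit].
apply/all_tnthP => i; have [j ->|-> //] := unliftP s i.
by have := pt j; rewrite tnth_mktuple.
Qed.

(** Moving a letter [a] from [t] to the right end of [w] does not change the
simplex.  A letter below [m] that now extends would differ from [a], since
[m < a]; being then independent of [a], it would have extended before. *)
Lemma minimal_extension_face n (w : M) (t : clique I n.+1) m (s : 'I_n.+1) :
  minimal_extension w t m ->
  minimal_extension (w * generator I (tnth (val t) s))%g (omit s t) m.
Proof.
move=> [/andP[mw mt] m_min]; set a := tnth (val t) s.
have /andP[ma Ima] : clique_rel I m a by move/all_tnthP: mt; apply.
split=> [|c]; rewrite /extends rquotM //.
  have -> : (a == m) = false by rewrite eq_sym lt_eqF.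
  by rewrite Ima all_omit // andbT; case: rquot mw.
have [<- _|_] := eqVneq a c; first exact: ltW.
case: ifP => // ca; case/andP=> cw ct; rewrite leNgt; apply/negP => cm.
suff /m_min : extends w t c by rewrite leNgt cm.
rewrite /extends (all_omitE _ s) ct andbT; apply/andP; split.
  by case: rquot cw.
by rewrite /clique_rel ca (lt_trans cm ma).
Qed.

(** The other case of the contraction: the least vertex already belongs to the
clique, and it becomes the least extension once it is moved to the trace. *)
Lemma minimal_extension_head n (w : M) (t : clique I n) m
    (mt : all (clique_rel I m) (val t)) :
  (forall c, ~~ extends w (cons_clique mt) c) ->
  minimal_extension (w * generator I m)%g t m.
Proof.
move=> w_max; split=> [|c]; rewrite /extends rquotM ?eqxx //.
have [<- //|_] := eqVneq m c; case: ifP => // cm /andP[cw ct].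
rewrite leNgt; apply/negP => ltcm; case/negP: (w_max c); apply/andP; split.
  by case: rquot cw.
by rewrite /= ct andbT /clique_rel cm ltcm.
Qed.

Lemma maximal_tail_face n (w : M) (t : clique I n.+1) m
    (mt : all (clique_rel I m) (val t)) (s : 'I_n.+1) :
  (forall c, ~~ extends w (cons_clique mt) c) -> forall c,
  ~~ extends (w * generator I (tnth (val t) s))%g
       (cons_clique (all_omit s mt)) c.
Proof.
move=> w_max c; apply/negP; rewrite /extends rquotM //= => /andP[].
have /andP[ms _] : clique_rel I m (tnth (val t) s).
  by move/all_tnthP: (mt); apply.
have [<- _ /andP[/andP[sm _] _]|_] := eqVneq (tnth (val t) s) c.
  by have := lt_trans sm ms; rewrite ltxx.
case: ifP => // cs cw /andP[/andP[cm Icm] ct].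
case/negP: (w_max c); apply/andP; split; first by case: rquot cw.
by rewrite /= (all_omitE _ s) ct /clique_rel cm Icm cs (lt_trans cm ms).
Qed.

End MinimalDivisor.

(** * Acyclicity of the clique complex of a free functor *)

Section LocallyNilpotent.
Variables (A : zmodType) (f : {additive A -> A}).

Definition nilpotent_at : pred A := fun u => `[< exists N, iter N f u = 0 >].

Lemma iterB N u v : iter N f (u - v) = iter N f u - iter N f v.
Proof. by elim: N => //= N ->; rewrite raddfB. Qed.

Fact nilpotent_at_zmod_closed : zmod_closed nilpotent_at.
Proof.
have iter0 N : iter N f 0 = 0 by elim: N => //= N ->; rewrite raddf0.
split=> [|u v /asboolP[N uN] /asboolP[N' vN]]; apply/asboolP; first by exists 0.
exists (N + N')%N; rewrite iterB {1}addnC !iterD uN vN !iter0.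
exact: subrr.
Qed.

Definition locally_nilpotent : zmodClosed A := HB.pack nilpotent_at
  (GRing.isZmodClosed.Build A nilpotent_at nilpotent_at_zmod_closed).

Lemma nilpotent_image u : f u \in locally_nilpotent -> u \in locally_nilpotent.
Proof.
by move=> /asboolP[N uN]; apply/asboolP; exists N.+1; rewrite iterSr.
Qed.

End LocallyNilpotent.

Section FreeAcyclic.
Variables (d : Order.disp_t) (E : orderType d) (I : rel E).
Hypotheses (I_irrefl : irreflexive I) (I_sym : symmetric I).
Variables (S : choiceType) (X : partial_action (trace_monoid I) S).
Variable G : functor (augmented_state_category X).
Notation M := (trace_monoid I).
Notation P := (free_functor G).

Section Cells.
Variables (x : augmented_state_category X) (a : G x).

(** The morphisms of the state category out of [x] correspond to the traces, so
for varying [x] and [a] these cells form a basis of the clique complex of the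
free functor. *)
Definition cell n (w : M) (t : clique I n) : Qsum P n :=
  Qin P (act_star X x w) t
    (fmap P (state_mor X x w) (free_in (free_elt a (idm x)) 1)).

Lemma Qin_free_elt n y (h : state_hom X x y) (t : clique I n) :
  Qin P y t (free_in (free_elt a (h : hom x y)) 1) = cell (val h) t.
Proof.
rewrite -[RHS](@Qin_cell _ _ _ _ _ P x _ _ y h); congr (Qin _ _ _ _).
rewrite [RHS]free_fmap_in.
by rewrite -[in LHS](@comp1m (augmented_state_category X) _ _ h).
Qed.

Lemma Qdiff_cellE n w (t : clique I n.+1) : Qdiff P n (cell w t) =
  \sum_(s < n.+1) (cell (w * generator I (tnth (val t) s))%g (omit s t)
                   - cell w (omit s t)) *~ (-1) ^+ s.+1.
Proof. exact: Qdiff_cell. Qed.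

(** The least extension [m] is moved from the trace to the front of the clique.
The minus sign compensates the sign of the face of index 0, which undoes this
move. *)
Fact contract_cell_subproof n (w : M) (t : clique I n) :
  exists u : Qsum P n.+1,
    (exists m v (mt : all (clique_rel I m) (val t)),
      [/\ minimal_extension w t m, rquot m w = Some v
        & u = - cell v (cons_clique mt)])
    \/ ((forall c, ~~ extends w t c) /\ u = 0).
Proof.
have [[m [v [mt [mm mv]]]]|no] := extension_cases I_irrefl I_sym w t.
  by exists (- cell v (cons_clique mt)); left; exists m, v, mt.
by exists 0; right.
Qed.

Definition contract_cell n w (t : clique I n) : Qsum P n.+1 :=
  sval (cid (contract_cell_subproof w t)).

Lemma contract_cell_minimal n w (t : clique I n) m v
    (mt : all (clique_rel I m) (val t)) :
  minimal_extension w t m -> rquot m w = Some v ->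
  contract_cell w t = - cell v (cons_clique mt).
Proof.
move=> mm mv; rewrite /contract_cell; case: cid => u /=.
case=> [[m' [v' [mt' [mm' mv' ->]]]]|[no _]]; last first.
  by have := no m; have [-> _] := mm.
have m'm := minimal_extension_unique mm' mm; subst m'.
by move: mv'; rewrite mv => -[<-]; rewrite (bool_irrelevance mt mt').
Qed.

Lemma contract_cell_maximal n w (t : clique I n) :
  (forall c, ~~ extends w t c) -> contract_cell w t = 0.
Proof.
move=> no; rewrite /contract_cell; case: cid => u /=.
case=> [[m [v [mt [[mm _] _ _]]]]|[] //].
by have := no m; rewrite mm.
Qed.

End Cells.

Section Contract.
Variable n : nat.

Definition contract : {additive Qsum P n -> Qsum P n.+1} :=
  dsum_rec (fun q : Qn I S n => dsum_rec (fun b : free_basis G q.1 =>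
    int_map (contract_cell (tagged b).1
      (val ((tagged b).2 : state_hom X (tag b) q.1)) q.2))).

Lemma contract_cellE x (a : G x) w (t : clique I n) :
  contract (cell a w t) = contract_cell a w t.
Proof.
have <- : Qin P (act_star X x w) t
    (free_in (free_elt a (state_mor X x w : hom x _)) 1) = cell a w t.
  exact: (Qin_free_elt a (state_mor X x w)).
by rewrite [LHS]dsum_rec_in [LHS]dsum_rec_in.
Qed.

End Contract.

(** The contraction would be a homotopy from the identity to zero if this map
vanished. *)
Definition contract_defect n : {additive Qsum P n.+1 -> Qsum P n.+1} :=
  idfun \- ((Qdiff P n.+1 \o contract n.+1) \+ (contract n \o Qdiff P n)).

Lemma contract_defectE n u : contract_defect n u =
  u - (Qdiff P n.+1 (contract n.+1 u) + contract n (Qdiff P n u)).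
Proof. by []. Qed.

Section Defect.
Variables (x : augmented_state_category X) (a : G x).

(** The faces that keep the product of trace and clique cancel, as in a
simplex.  The cells that remain have traces shorter than [w]: [v] itself, or
the quotients that arise when cells with trace [w] are contracted. *)
Lemma contract_defect_cell_minimal n (w v : M) (t : clique I n.+1) m
    (mt : all (clique_rel I m) (val t)) :
  minimal_extension w t m -> rquot m w = Some v ->
  contract_defect n (cell a w t) = cell a v t +
    \sum_(s < n.+1) (cell a v (cons_clique (all_omit s mt)) +
                     contract_cell a w (omit s t)) *~ (-1) ^+ s.+1.
Proof.
move=> mm mv.
have face (s : 'I_n.+1) :
    contract_cell a (w * generator I (tnth (val t) s))%g (omit s t) =
    - cell a (v * generator I (tnth (val t) s))%g (cons_clique (all_omit s mt)).
  have mm' := minimal_extension_face I_irrefl I_sym s mm.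
  apply: (contract_cell_minimal a _ mm').
  rewrite rquotM // mv; have /andP[ms Ims] : clique_rel I m (tnth (val t) s).
    by move/all_tnthP: mt; apply.
  by rewrite gt_eqF // Ims.
pose C s :=
  cell a (v * generator I (tnth (val t) s))%g (cons_clique (all_omit s mt)).
pose L s := cell a v (cons_clique (all_omit s mt)).
pose K s := contract_cell a w (omit s t).
have -> : contract_defect n (cell a w t) = cell a w t
    + Qdiff P n.+1 (cell a v (cons_clique mt))
    - contract n (Qdiff P n (cell a w t)).
  rewrite contract_defectE contract_cellE (contract_cell_minimal a mt mm mv).
  by rewrite raddfN opprD opprK addrA.
have -> : Qdiff P n.+1 (cell a v (cons_clique mt)) =
    cell a v t - cell a w t - \sum_(s < n.+1) (C s - L s) *~ (-1) ^+ s.+1.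
  rewrite Qdiff_cellE big_ord_recl omit_cons0 tnth0 -(rquotK I_irrefl I_sym mv).
  rewrite expr1 mulrNz mulr1z opprB -sumrN; congr (_ + _).
  apply: eq_bigr => s _.
  by rewrite omit_consS tnthS lift0 [_ ^+ s.+2]exprS mulN1r mulrNz.
have -> : contract n (Qdiff P n (cell a w t)) =
    - \sum_(s < n.+1) (C s + K s) *~ (-1) ^+ s.+1.
  rewrite Qdiff_cellE raddf_sum -sumrN; apply: eq_bigr => s _.
  by rewrite raddfMz raddfB !contract_cellE face -opprD mulNrz.
rewrite opprK addrA [cell a w t + _]addrC subrK -addrA; congr (_ + _).
rewrite addrC -sumrB; apply: eq_bigr => s _.
by rewrite -mulrzBl opprB [C s + _]addrC addrACA subrr addr0 addrC.
Qed.

(** Here the least vertex is the head of [t].  Of the faces that keep the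
product, only the one omitting this head has a nonzero contraction, and it
gives back the cell. *)
Lemma contract_defect_cell_maximal n (w : M) (t : clique I n.+1) :
  (forall c, ~~ extends w t c) -> contract_defect n (cell a w t) =
    \sum_(s < n.+1) contract_cell a w (omit s t) *~ (-1) ^+ s.+1.
Proof.
move=> w_max; rewrite contract_defectE contract_cellE contract_cell_maximal //.
rewrite raddf0 add0r.
have -> : contract n (Qdiff P n (cell a w t)) =
    \sum_(s < n.+1)
      contract_cell a (w * generator I (tnth (val t) s))%g (omit s t)
        *~ (-1) ^+ s.+1
    - \sum_(s < n.+1) contract_cell a w (omit s t) *~ (-1) ^+ s.+1.
  rewrite Qdiff_cellE raddf_sum -sumrB; apply: eq_bigr => s _.
  by rewrite raddfMz raddfB !contract_cellE mulrzBl.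
rewrite opprB addrCA [X in _ + X](_ : _ = 0) ?addr0 //.
have [m [t' [mt tE]]] := uncons_clique t; subst t.
rewrite big_ord_recl omit_cons0 tnth0 expr1 mulrNz mulr1z.
have wm := minimal_extension_head I_irrefl I_sym w_max.
have wmw : rquot m (w * generator I m)%g = Some w by rewrite rquotM // eqxx.
rewrite (contract_cell_minimal a mt wm wmw).
rewrite opprK big1 ?addr0 ?subrr // => s _.
case: n t' mt w_max wm s => [|n] t' mt w_max wm s; first by case: s.
rewrite omit_consS tnthS contract_cell_maximal ?mul0rz //.
exact: maximal_tail_face.
Qed.

Lemma cell_nilpotent n w (t : clique I n.+1) :
  cell a w t \in locally_nilpotent (contract_defect n).
Proof.
have [l] := ubnP (trace_length w); elim: l w t => // l IH w t wl.
have low v b : rquot b w = Some v -> (trace_length v < l)%N.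
  by move=> /(rquotK I_irrefl I_sym) wE; move: wl; rewrite wE trace_lengthM.
have contract_nilpotent (t' : clique I n) :
    contract_cell a w t' \in locally_nilpotent (contract_defect n).
  have [[m [v [mt [mm mv]]]]|no] := extension_cases I_irrefl I_sym w t'.
    rewrite (contract_cell_minimal a mt mm mv) rpredN; apply: IH.
    exact: low mv.
  by rewrite contract_cell_maximal ?rpred0.
apply: nilpotent_image.
have [[m [v [mt [mm mv]]]]|no] := extension_cases I_irrefl I_sym w t.
  have IHv (t' : clique I n.+1) := IH v t' (low _ _ mv).
  rewrite (contract_defect_cell_minimal mt mm mv) rpredD ?IHv //.
  by rewrite rpred_sum // => s _; rewrite rpredMz ?rpredD ?IHv.
rewrite contract_defect_cell_maximal //.
by rewrite rpred_sum // => s _; rewrite rpredMz.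
Qed.

End Defect.

Lemma contract_defect_nilpotent n u :
  u \in locally_nilpotent (contract_defect n).
Proof.
elim/dsum_ind: u => [|u v|[y t] b]; [exact: rpred0|exact: rpredD|].
rewrite -[dsum_in _ _]/(Qin P y t b).
have [r ur br] := dsum_suppP b; rewrite (dsum_decomp ur br) raddf_sum.
apply: rpred_sum => -[x [a h]] _; set z := val b _.
rewrite -[X in X \in _]/(Qin P y t (free_in (free_elt a h) z)).
rewrite -[z]intz !raddfMz rpredMz //.
by rewrite (Qin_free_elt a (h : state_hom X x y)) cell_nilpotent.
Qed.

(** On a cycle [u] the defect is [u] minus the boundary of its contraction;
iterating it until it vanishes exhibits [u] as a boundary. *)
Theorem free_clique_acyclic n (u : Qsum P n.+1) :
  Qdiff P n u = 0 -> exists v, Qdiff P n.+1 v = u.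
Proof.
have /asboolP[N] := contract_defect_nilpotent u.
elim: N u => [|N IH] u.
  by move=> u0 _; exists 0; rewrite raddf0; exact: esym u0.
rewrite iterSr => uN du.
have defE : contract_defect n u = u - Qdiff P n.+1 (contract n.+1 u).
  by rewrite contract_defectE du raddf0 addr0.
have [|v vE] := IH _ uN; first by rewrite defE raddfB du QdiffK subrr.
exists (v + contract n.+1 u); rewrite raddfD vE defE; exact: subrK.
Qed.

End FreeAcyclic.

(** * The clique complex as an exact functor, with the colimit in degree 0 *)

Section CliqueComplexMap.
Variables (d : Order.disp_t) (E : orderType d) (I : rel E).
Variables (S : choiceType) (X : partial_action (trace_monoid I) S).
Notation functors := (functor (augmented_state_category X)).

Section Map.
Variables (F G : functors) (eta : nat_trans F G).

Definition Qmap n : {additive Qsum F n -> Qsum G n} :=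
  dsum_map (fun q : Qn I S n => eta q.1).

Lemma Qmap_in n x (t : clique I n) a :
  Qmap n (Qin F x t a) = Qin G x t (eta x a).
Proof. exact: (@dsum_map_in (Qn I S n)). Qed.

Lemma Qmap_diff n u : Qmap n (Qdiff F n u) = Qdiff G n (Qmap n.+1 u).
Proof.
pose l : {additive Qsum F n.+1 -> Qsum G n} := Qmap n \o Qdiff F n.
pose r : {additive Qsum F n.+1 -> Qsum G n} := Qdiff G n \o Qmap n.+1.
apply: (@dsum_ext _ _ _ l r) => -[x t] a.
rewrite -[LHS]/(Qmap n (Qdiff F n (Qin F x t a))).
rewrite -[RHS]/(Qdiff G n (Qmap n.+1 (Qin F x t a))).
rewrite Qmap_in !Qdiff_in raddf_sum; apply: eq_bigr => s _.
rewrite raddfMz raddfB; congr (_ *~ _); congr (_ - _); last exact: Qmap_in.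
by rewrite [LHS]Qmap_in ntr_nat.
Qed.

End Map.

Section Augmentation.
Variable F : functors.

Definition clique0 : clique I 0 :=
  exist (fun t : 0.-tuple E => pairwise (clique_rel I) t) [tuple] isT.

Lemma clique0E (t : clique I 0) : t = clique0.
Proof. by apply/val_inj; rewrite [LHS]tuple0. Qed.

Definition Qaug : {additive Qsum F 0 -> colim F} :=
  dsum_rec (fun q : Qn I S 0 => colim_in F q.1).

Lemma Qaug_in x t a : Qaug (Qin F x t a) = colim_in F x a.
Proof. by rewrite [LHS]dsum_rec_in. Qed.

Lemma Qaug_surj c : exists u, Qaug u = c.
Proof.
have [b <-] := coker_piP c; elim/dsum_ind: b => [|b b' [u uE] [u' u'E]|x a].
- by exists 0; rewrite !raddf0.
- by exists (u + u'); rewrite raddfD uE u'E raddfD.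
- by exists (Qin F x clique0 a); rewrite Qaug_in.
Qed.

Definition vertex_class x : {additive F x -> coker (Qdiff F 0)} :=
  coker_pi (Qdiff F 0) \o Qin F x clique0.

(** The relations that define the colimit are indexed by all morphisms, the
boundaries of edges only by the letters; writing a trace as a product of
letters bridges the gap. *)
Lemma vertex_class_nat x y (f : hom x y) a :
  vertex_class y (fmap F f a) = vertex_class x a.
Proof.
rewrite -[LHS]/(coker_pi _ (Qin F y clique0 (fmap F f a))).
rewrite -[RHS]/(coker_pi _ (Qin F x clique0 a)).
rewrite (@Qin_cell _ _ _ _ _ F x a 0 y f) (@Qin_cell1 _ _ _ _ _ F x a) /=.
move: (val _) => w; elim/trace_rcons_ind: w => // w m <-.
apply/eqP; rewrite -subr_eq0 -raddfB; apply/eqP/coker_pi_eq0.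
have m0 : all (clique_rel I m) (val clique0) by [].
exists (- Qin F (act_star X x w) (cons_clique m0) (fmap F (state_mor X x w) a)).
rewrite raddfN Qdiff_cell big_ord1 omit_cons0 tnth0 expr1.
by rewrite mulrNz mulr1z opprK.
Qed.

Lemma vertex_class_aug u :
  colim_rec vertex_class_nat (Qaug u) = coker_pi (Qdiff F 0) u.
Proof.
pose l : {additive Qsum F 0 -> coker (Qdiff F 0)} :=
  colim_rec vertex_class_nat \o Qaug.
apply: (@dsum_ext _ _ _ l (coker_pi (Qdiff F 0))) => -[x t] a.
rewrite -[LHS]/(colim_rec vertex_class_nat (Qaug (Qin F x t a))).
by rewrite Qaug_in colim_rec_in (clique0E t).
Qed.

Lemma Qaug_diff v : Qaug (Qdiff F 0 v) = 0.
Proof.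
apply: (@dsum_ext _ _ _ (Qaug \o Qdiff F 0) \0) v => -[x t] a.
rewrite -[LHS]/(Qaug (Qdiff F 0 (Qin F x t a))) -[RHS]/0 Qdiff_in big_ord1.
rewrite raddfMz raddfB [Qaug (Qin _ _ _ _)]Qaug_in Qaug_in colim_in_nat.
by rewrite subrr mul0rz.
Qed.

Lemma Qaug_exact u : Qaug u = 0 <-> exists v, Qdiff F 0 v = u.
Proof.
split=> [u0|[v <-]]; last exact: Qaug_diff.
by apply/coker_pi_eq0; rewrite -vertex_class_aug u0 raddf0.
Qed.

End Augmentation.

Lemma Qaug_map (F G : functors) (eta : nat_trans F G) u :
  Qaug G (Qmap eta 0 u) = colim_map eta (Qaug F u).
Proof.
apply: (@dsum_ext _ _ _ (Qaug G \o Qmap eta 0) (colim_map eta \o Qaug F)) u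
  => -[x t] a.
rewrite -[LHS]/(Qaug G (Qmap eta 0 (Qin F x t a))).
rewrite -[RHS]/(colim_map eta (Qaug F (Qin F x t a))).
by rewrite Qmap_in !Qaug_in colim_map_in.
Qed.

Section ShortExact.
Variables (F0 F1 F2 : functors) (i : nat_trans F0 F1) (p : nat_trans F1 F2).

Lemma Qmap_surj n : epi p -> forall v, exists u, Qmap p n u = v.
Proof. by move=> p_epi; apply: dsum_map_surj => q b; exact: p_epi. Qed.

Lemma Qmap_inj n : (forall x, injective (i x)) -> injective (Qmap i n).
Proof. by move=> i_inj; apply: dsum_map_inj => q; exact: i_inj. Qed.

Lemma Qmap_exact n : exact_at i p ->
  forall v, Qmap p n v = 0 <-> exists u, Qmap i n u = v.
Proof.
move=> ip v; split=> [|[u <-]].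
  by apply: dsum_map_exact => q b /ip.
apply: dsumP => q; rewrite !dsum_mapE.
by have [_ ->] := ip q.1 (i q.1 (val u q)); last by exists (val u q).
Qed.

Hypotheses (i_inj : forall x, injective (i x)) (p_epi : epi p).
Hypothesis ip : exact_at i p.
Hypothesis acyclic : forall n (u : Qsum F1 n.+1),
  Qdiff F1 n u = 0 -> exists v, Qdiff F1 n.+1 v = u.

(** The connecting isomorphism of the long exact sequence, as the relation that
lifts a chain [c] to [x] and takes the boundary of [x]. *)
Lemma clique_homology_shift n :
  zmod_isomorphic (homology (clique_complex F0) n.+1)
                  (homology (clique_complex F2) n.+2).
Proof.
pose R (e : Qsum F0 n.+1) (c : Qsum F2 n.+2) :=
  exists2 x, Qmap p n.+2 x = c & Qdiff F1 n.+1 x = Qmap i n.+1 e.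
apply: (@homology_isomorphic_rel (clique_complex F0) (clique_complex F2)
  n.+1 n.+2 R).
- move=> e e' c c' [x xc xe] [x' x'c' x'e'].
  by exists (x - x'); rewrite !raddfB ?xc ?x'c' ?xe ?x'e'.
- move=> e; rewrite -[is_cycle e]/(Qdiff F0 n e = 0) => de.
  have [|x xe] := @acyclic n (Qmap i n.+1 e).
    by rewrite -Qmap_diff de raddf0.
  exists (Qmap p n.+2 x); last by exists x.
  rewrite -[is_cycle _]/(Qdiff F2 n.+1 _ = 0) -Qmap_diff xe.
  by apply/(Qmap_exact ip); exists e.
- move=> c; rewrite -[is_cycle c]/(Qdiff F2 n.+1 c = 0) => dc.
  have [x xc] := Qmap_surj p_epi c.
  have /(Qmap_exact ip)[e xe] : Qmap p n.+1 (Qdiff F1 n.+1 x) = 0.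
    by rewrite Qmap_diff xc.
  exists e; last by exists x.
  apply: (Qmap_inj i_inj).
  by rewrite -[X in Qmap i n X]/(Qdiff F0 n e) Qmap_diff xe QdiffK raddf0.
- move=> e c [x xc xe].
  split=> -[y]; rewrite -[diff _ _ y]/(Qdiff _ _ y) => ye.
    have [|z zE] := @acyclic n.+1 (x - Qmap i n.+2 y).
      by rewrite raddfB xe -ye Qmap_diff subrr.
    exists (Qmap p n.+3 z).
    rewrite -[LHS]/(Qdiff _ _ _) -Qmap_diff zE raddfB xc.
    rewrite [X in _ - X](_ : _ = 0) ?subr0 //.
    by apply/(Qmap_exact ip); exists y.
  have [z zy] := Qmap_surj p_epi y.
  have /(Qmap_exact ip)[y' y'E] : Qmap p n.+2 (x - Qdiff F1 n.+2 z) = 0.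
    by rewrite raddfB xc Qmap_diff zy -ye subrr.
  exists y'; apply: (Qmap_inj i_inj).
  rewrite -[X in Qmap i _ X = _]/(Qdiff F0 n.+1 y') Qmap_diff y'E raddfB xe.
  by rewrite QdiffK subr0.
Qed.

End ShortExact.

End CliqueComplexMap.

(** * Comparison with the standard resolution *)

Section KernelInclusion.
Variables (C : category) (G F : functor C) (eta : nat_trans G F).

Fact ker_inclusion_nat x y (f : hom x y) a :
  @ker_val _ _ (eta y) (fmap (ker_functor eta) f a) =
  fmap G f (@ker_val _ _ (eta x) a).
Proof. by []. Qed.

Definition ker_inclusion : nat_trans (ker_functor eta) G :=
  NatTrans ker_inclusion_nat.

Lemma ker_inclusion_inj x : injective (ker_inclusion x).
Proof. exact: val_inj. Qed.

Lemma ker_inclusion_exact : exact_at ker_inclusion eta.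
Proof.
move=> x b; split=> [b0|[a <-]]; last exact: kerP.
have kb : kerf (eta x) b by exact/eqP.
by exists (exist _ b kb : ker (eta x)).
Qed.

End KernelInclusion.

(** Here P2 -> P1 -> P0 -> K is a stretch of the standard resolution.  The
relation [corner] is the zigzag through the double complex of clique chains
that leads from the augmentation of its column P1 to the clique chains of K. *)
Section Corner.
Variables (d : Order.disp_t) (E : orderType d) (I : rel E).
Variables (S : choiceType) (X : partial_action (trace_monoid I) S).
Variables P2 P1 P0 K : functor (augmented_state_category X).
Variables (D1 : nat_trans P2 P1) (D0 : nat_trans P1 P0) (p : nat_trans P0 K).
Hypotheses (p_epi : epi p) (D0p : exact_at D0 p) (D1D0 : exact_at D1 D0).
Hypothesis acyclic : forall u, Qdiff P0 0 u = 0 -> exists v, Qdiff P0 1 v = u.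

Definition corner (c : colim P1) (e : Qsum K 1) : Prop :=
  exists x y, [/\ Qaug P1 y = c, Qmap p 1 x = e & Qdiff P0 0 x = Qmap D0 0 y].

Lemma cornerB c c' e e' :
  corner c e -> corner c' e' -> corner (c - c') (e - e').
Proof.
move=> [x [y [<- <- xy]]] [x' [y' [<- <- xy']]].
by exists (x - x'), (y - y'); rewrite !raddfB xy xy'.
Qed.

Lemma corner_left c : colim_map D0 c = 0 ->
  exists2 e, Qdiff K 0 e = 0 & corner c e.
Proof.
move=> dc; have [y yc] := Qaug_surj c.
have /Qaug_exact[x xy] : Qaug P0 (Qmap D0 0 y) = 0 by rewrite Qaug_map yc.
exists (Qmap p 1 x); last by exists x, y.
by rewrite -Qmap_diff xy; apply/(Qmap_exact D0p); exists y.
Qed.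

Lemma corner_right e : Qdiff K 0 e = 0 ->
  exists2 c, colim_map D0 c = 0 & corner c e.
Proof.
move=> de; have [x xe] := Qmap_surj p_epi e.
have /(Qmap_exact D0p)[y xy] : Qmap p 0 (Qdiff P0 0 x) = 0.
  by rewrite Qmap_diff xe.
exists (Qaug P1 y); last by exists x, y.
by rewrite -Qaug_map xy Qaug_diff.
Qed.

Lemma corner_boundary c e : corner c e ->
  (exists b, colim_map D1 b = c) <-> (exists b, Qdiff K 1 b = e).
Proof.
move=> [x [y [yc xe xy]]]; split=> -[b bE].
  have [y' y'b] := Qaug_surj b.
  have /Qaug_exact[z zE] : Qaug P1 (y - Qmap D1 0 y') = 0.
    by rewrite raddfB Qaug_map yc y'b bE subrr.
  (* [x] itself is not a cycle; [z] accounts for the difference between [y] and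
     a chain coming from P2. *)
  have [|u uE] := acyclic (u := x - Qmap D0 1 z).
    rewrite raddfB -Qmap_diff zE raddfB xy opprB addrC subrK.
    by apply/(Qmap_exact D1D0); exists y'.
  exists (Qmap p 2 u); rewrite -Qmap_diff uE raddfB xe.
  rewrite [X in _ - X](_ : _ = 0) ?subr0 //.
  by apply/(Qmap_exact D0p); exists z.
have [u ub] := Qmap_surj p_epi b.
have /(Qmap_exact D0p)[z zE] : Qmap p 1 (x - Qdiff P0 1 u) = 0.
  by rewrite raddfB xe Qmap_diff ub bE subrr.
have /(Qmap_exact D1D0)[y' y'E] : Qmap D0 0 (y - Qdiff P1 0 z) = 0.
  by rewrite raddfB Qmap_diff zE raddfB QdiffK subr0 xy subrr.
by exists (Qaug P2 y'); rewrite -Qaug_map y'E raddfB yc Qaug_diff subr0.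
Qed.

End Corner.

Section Comparison.
Variables (d : Order.disp_t) (E : orderType d) (I : rel E).
Hypotheses (I_irrefl : irreflexive I) (I_sym : symmetric I).
Variables (S : choiceType) (X : partial_action (trace_monoid I) S).
Variable F : functor (augmented_state_category X).

Notation K := (syzygy F).
Notation P m := (free_functor (K m)).
Notation pi := (fun m => free_aug (K m)).
Notation D := (std_diff F).

Lemma syzygy_homology_shift k m :
  zmod_isomorphic (homology (clique_complex (K m)) k.+1)
                  (homology (clique_complex F) (m + k).+1).
Proof.
elim: m k => [|m IH] k; first by exists idfun; exists idfun.
apply: zmod_isomorphic_trans (_ : zmod_isomorphic _ _) _; last first.
  by rewrite addSnnS; exact: IH.
apply: (@clique_homology_shift _ _ _ _ _ _ _ _ (ker_inclusion (pi m)) (pi m)).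
- exact: ker_inclusion_inj.
- exact: free_aug_epi.
- exact: ker_inclusion_exact.
- exact: free_clique_acyclic.
Qed.

(** The same chase in degree 0, where both sides are the colimit of F. *)
Lemma derived_colim0_clique :
  zmod_isomorphic (derived_colim 0 F) (homology (clique_complex F) 0).
Proof.
have exF : exact_at (D 0) (free_aug F) := @std_exact _ F 0.
pose R (c : colim (P 0)) (e : Qsum F 0) :=
  exists2 y, Qaug (P 0) y = c & Qmap (free_aug F) 0 y = e.
apply: (@homology_isomorphic_rel (colim_complex (std_resolution F))
  (clique_complex F) 0 0 R).
- by move=> c c' e e' [y <- <-] [y' <- <-]; exists (y - y'); rewrite raddfB.
- move=> c _; have [y yc] := Qaug_surj c.
  by exists (Qmap (free_aug F) 0 y) => //; exists y.
- move=> e _; have [y ye] := Qmap_surj (@free_aug_epi _ F) e.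
  by exists (Qaug (P 0) y) => //; exists y.
move=> c e [y yc ye]; split=> -[b].
  rewrite -[diff _ _ b]/(colim_map (D 0) b) => bc.
  have [y' y'b] := Qaug_surj b.
  have /Qaug_exact[x xE] : Qaug (P 0) (y - Qmap (D 0) 0 y') = 0.
    by rewrite raddfB Qaug_map yc y'b bc subrr.
  exists (Qmap (free_aug F) 1 x); rewrite -[LHS]/(Qdiff F 0 _) -Qmap_diff xE.
  rewrite raddfB ye [X in _ - X](_ : _ = 0) ?subr0 //.
  by apply/(Qmap_exact exF); exists y'.
rewrite -[diff _ _ b]/(Qdiff F 0 b) => be.
have [x xb] := Qmap_surj (@free_aug_epi _ F) b.
have /(Qmap_exact exF)[y' y'E] :
    Qmap (free_aug F) 0 (y - Qdiff (P 0) 0 x) = 0.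
  by rewrite raddfB ye Qmap_diff xb be subrr.
exists (Qaug (P 1) y'); rewrite -[LHS]/(colim_map (D 0) _) -Qaug_map y'E.
by rewrite raddfB yc Qaug_diff subr0.
Qed.

(** Both sides are isomorphic to the kernel of the map induced on colimits by
the inclusion of the next syzygy into the free functor that covers K_m. *)
Lemma derived_colimS_clique m :
  zmod_isomorphic (derived_colim m.+1 F) (homology (clique_complex (K m)) 1).
Proof.
have p_epi : epi (pi m) := @free_aug_epi _ (K m).
have D0p : exact_at (D m) (pi m) := @std_exact _ F m.
have D1D0 : exact_at (D m.+1) (D m) := @std_exactS _ F m.
have P_acyclic u : Qdiff (P m) 0 u = 0 -> exists v, Qdiff (P m) 1 v = u.
  exact: free_clique_acyclic.
apply: (@homology_isomorphic_rel (colim_complex (std_resolution F))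
  (clique_complex (K m)) m.+1 1 (corner (D m) (pi m))).
- exact: cornerB.
- exact: corner_left D0p.
- exact: corner_right D0p.
- exact: corner_boundary D1D0 P_acyclic.
Qed.

End Comparison.

Theorem theorem3p5 (d : Order.disp_t) (E : orderType d) (I : rel E)
    (I_irrefl : irreflexive I) (I_sym : symmetric I)
    (S : choiceType) (X : partial_action (trace_monoid I) S)
    (F : functor (augmented_state_category X))
    (I_fin : ~ exists A : set E, infinite_set A /\
               forall a b : E, A a -> A b -> a <> b -> I a b)
    (n : nat) :
  zmod_isomorphic (derived_colim n F) (homology (clique_complex F) n).
Proof.
case: n => [|m]; first exact: derived_colim0_clique.
apply: zmod_isomorphic_trans (derived_colimS_clique I_irrefl I_sym F m) _.
by have := syzygy_homology_shift I_irrefl I_sym F 0 m; rewrite addn0.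
Qed.
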